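(* Let $k\ge1$, let $x\in\tilde S_{k+1}$ be an affine permutation, and let $\alpha$ be the $k$-code obtained from the maximal decomposition of $x$ into cyclically decreasing elements. Let $\mathfrak Q$ be the set of recording tableaux associated to $\alpha$, i.e. the set of all $Q(w)$ where $w$ runs over the reduced words (of affine permutations in $\tilde S_{k+1}$) whose insertion is the $k$-code $\alpha$. Then $\mathfrak Q$ is in bijection, via $w\mapsto Q(w)$, with the set of reduced words for $x$.
   Context: Fix $k\ge1$, $I=\mathbb Z/(k+1)\mathbb Z$. $\tilde S_{k+1}$ is the affine symmetric group with simple generators $s_i$ ($i\in I$). The affine nil-Coxeter monoid is generated by $a_i$ ($i\in I$) and an absorbing zero, with relations $a_i^2=0$, $a_ia_j=a_ja_i$ for $j\notin\{i-1,i,i+1\}$, and (for $k\ge2$) $a_ia_{i+1}a_i=a_{i+1}a_ia_{i+1}$; its nonzero elements are identified with affine permutations via reduced words. For $A\subsetneq I$, $d_A$ is the product of the $a_i$, $i\in A$, each once, with $a_j$ left of $a_{j-1}$ whenever $j,j-1\in A$. Every affine permutation has a unique decomposition $x=d_{A_n}\cdots d_{A_1}$ ($A_i\subsetneq I$ nonempty) whose shape $(|A_1|,\dots,|A_n|)$ is lexicographically maximal, and it satisfies $A_{j+1}\subset A_j-1:=\{s-1:s\in A_j\}$. A $k$-code is a function $\alpha:I\to\mathbb Z_{\ge0}$ with at least one zero value. Its diagram lives on a cylinder with columns indexed by $I$; column $i$ has $\alpha_i$ boxes, in rows $1,\dots,\alpha_i$ (row 1 at the bottom); in the filling, the box in column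 $i$ and row $j$ carries residue $i-(j-1)$. The $k$-code of $x$ is the $\alpha$ whose filling has in row $j$ exactly the residues in $A_j$. Insertion of a residue $p$ into a filling with rows $A_1,A_2,\dots$ (with $A_j=\emptyset$ beyond the last row): start with $j=1$ and the residue $p$, and repeat: (Inclusion) if $p-1,p\notin A_j$: put $p$ into $A_j$ and halt. (Bump) if $p\notin A_j$ and $p-1\in A_j$: remove $p-1$ from $A_j$, put $p$ into $A_j$, and continue by inserting $p-1$ into row $j+1$. (Braid) if $p\in A_j$ and $p-1\in A_j$: leave $A_j$ unchanged and continue by inserting $p-1$ into row $j+1$. (If $p\in A_j$ and $p-1\notin A_j$ the product is zero; this does not occur for reduced words.) The insertion of a reduced word $w=[w_1,\dots,w_n]$ is the filling obtained by inserting $w_1$, then $w_2$, ..., then $w_n$, starting from the empty filling. The recording tableau $Q(w)$ is the labelling of the boxes of the resulting diagram by $1,\dots,n$ produced as follows: when the $j$-th letter is inserted, the box finally added by the Inclusion step is labelled $j$; whenever a Bump move replaces the box of residue $p-1$ in a row by the box of residue $p$ in that row, the label of the removed box is transferred to the new box. *)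

(* Defs.v *)
(* Written in the MathComp world; only the set-theoretic notions (sets of
   words, set_bij) come from MathComp-Analysis' classical layer. *)
From mathcomp Require Import all_boot all_order all_algebra.
From mathcomp Require Import mathcomp_extra boolp classical_sets functions.

Set Implicit Arguments.
Unset Strict Implicit.
Unset Printing Implicit Defensive.

Import Order.TTheory GRing.Theory Num.Theory.

Local Open Scope ring_scope.

(* For k >= 1 (a hypothesis of the theorem), 'Z_k.+1 is Z/(k+1)Z. *)
Notation residue k := ('Z_k.+1).
Notation word k := (seq (residue k)).

(* The affine symmetric group is realized as the group of (k+1)-periodic
   bijections x of Z, normalized by x(1) + ... + x(k+1) = 1 + ... + (k+1). *)
Definition affine_perm (k : nat) (x : int -> int) : Prop :=
  [/\ bijective x,
      forall m, x (m + k.+1%:Z) = x m + k.+1%:Z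
    & \sum_(1 <= m < k.+2) x m%:Z = 'C(k.+2, 2)%:Z].

(* s_i exchanges m and m + 1 for every integer m congruent to i. *)
Definition simple_refl (k : nat) (i : residue k) (m : int) : int :=
  if m%:~R == i then m + 1 else if m%:~R == i + 1 then m - 1 else m.

(* The product s_(w_1) s_(w_2) ... s_(w_n). *)
Definition word_perm (k : nat) (w : word k) : int -> int :=
  foldr (fun i f => simple_refl i \o f) id w.

Definition reduced_word (k : nat) (x : int -> int) (w : word k) : Prop :=
  word_perm w =1 x /\
  forall v : word k, word_perm v =1 x -> (size w <= size v)%N.

(* The congruence presenting the affine nil-Coxeter monoid: Some w stands for
   the product a_(w_1) ... a_(w_n), and None for the absorbing zero. *)
Inductive nilcoxeter_eq (k : nat) : option (word k) -> option (word k) -> Prop :=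
| nilcoxeter_refl a : nilcoxeter_eq a a
| nilcoxeter_sym a b : nilcoxeter_eq a b -> nilcoxeter_eq b a
| nilcoxeter_trans a b c :
    nilcoxeter_eq a b -> nilcoxeter_eq b c -> nilcoxeter_eq a c
| nilcoxeter_square (u : word k) (i : residue k) (v : word k) :
    nilcoxeter_eq (Some (u ++ [:: i; i] ++ v)) None
| nilcoxeter_comm (u : word k) (i j : residue k) (v : word k) :
    j \notin [:: i - 1; i; i + 1] ->
    nilcoxeter_eq (Some (u ++ [:: i; j] ++ v)) (Some (u ++ [:: j; i] ++ v))
| nilcoxeter_braid (u : word k) (i : residue k) (v : word k) :
    (2 <= k)%N ->
    nilcoxeter_eq (Some (u ++ [:: i; i + 1; i] ++ v))
                  (Some (u ++ [:: i + 1; i; i + 1] ++ v)).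

(* The identification of nonzero nil-Coxeter elements with affine
   permutations: x corresponds to the common class of its reduced words. *)
Definition nilcoxeter_perm (k : nat) (a : option (word k)) (x : int -> int) :=
  exists2 r : word k, reduced_word x r & nilcoxeter_eq a (Some r).

(* u spells d_A; all such u are equal in the nil-Coxeter monoid. *)
Definition cyc_decreasing_word (k : nat) (A : {set residue k}) (u : word k) :=
  [&& uniq u, [set i in u] == A &
      [forall j in A, (j - 1 \in A) ==> (index j u < index (j - 1)%R u)%N]].

(* As = [:: A_1; ...; A_n] encodes x = d_(A_n) ... d_(A_1): the list starts
   with the rightmost factor. *)
Definition cyc_decomposition (k : nat) (x : int -> int)
    (As : seq {set residue k}) : Prop :=
  all (fun A : {set residue k} =>
         (A != finset.set0) && (A != [set: residue k])) As /\
  exists2 us : seq (word k), all2 (@cyc_decreasing_word k) As us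
    & nilcoxeter_perm (Some (flatten (rev us))) x.

Definition decomposition_shape (k : nat) (As : seq {set residue k}) : seq nat :=
  [seq #|A| | A : {set residue k} <- As].

Definition max_cyc_decomposition (k : nat) (x : int -> int)
    (As : seq {set residue k}) : Prop :=
  cyc_decomposition x As /\
  forall Bs : seq {set residue k}, cyc_decomposition x Bs ->
    (decomposition_shape Bs <= decomposition_shape As :> seqlexi nat)%O.

Definition is_kcode (k : nat) (alpha : {ffun residue k -> nat}) : Prop :=
  exists i, alpha i = 0%N.

(* Rows are numbered from 0, bottom to top: the box in column i and row j
   exists when j < alpha i, and carries the residue i - j. *)
Definition code_filling (k : nat) (alpha : {ffun residue k -> nat}) :
    seq {set residue k} :=
  [seq [set i - j%:R | i : residue k & (j < alpha i)%N]
     | j <- iota 0 (\max_i alpha i)].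

Definition kcode_of (k : nat) (x : int -> int)
    (alpha : {ffun residue k -> nat}) : Prop :=
  is_kcode alpha /\ max_cyc_decomposition x (code_filling alpha).

(* A row of a filling together with the labels of its boxes: the residue p is
   in the row iff its value is Some l, where l is the label of its box. *)
Notation labelled_row k := {ffun residue k -> option nat}.

Definition row_residues (k : nat) (A : labelled_row k) : {set residue k} :=
  [set p | A p != None].

(* Insertion of p into the rows T, where a box created by an Inclusion step
   gets the label l; None is the case of a zero product.  The rows beyond the
   end of T are empty, so that inserting into [::] is an Inclusion. *)
Fixpoint insert (k : nat) (T : seq (labelled_row k)) (p : residue k) (l : nat) :
    option (seq (labelled_row k)) :=
  match T with
  | [::] => Some [:: [ffun q => if q == p then Some l else None]]
  | A :: T' =>
    match A p, A (p - 1) with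
    | None, None => Some ([ffun q => if q == p then Some l else A q] :: T')
    | None, Some l' =>
        omap (cons [ffun q => if q == p then Some l'
                              else if q == p - 1 then None else A q])
             (insert T' (p - 1) l)
    | Some _, Some _ => omap (cons A) (insert T' (p - 1) l)
    | Some _, None => None
    end
  end.

Definition insert_word (k : nat) (w : word k) :
    option (seq (labelled_row k)) :=
  foldl (fun o pl => obind (fun T => insert T pl.1 pl.2) o) (Some [::])
        (zip w (iota 1 (size w))).

Definition insertion (k : nat) (w : word k) : option (seq {set residue k}) :=
  omap (map (@row_residues k)) (insert_word w).

(* Q(w) maps the box in column i and row j (numbered from 0) to its label, and
   (i, j) to None outside of the diagram. *)
Definition recording (k : nat) (w : word k) (i : residue k) (j : nat) :
    option nat :=
  if insert_word w is Some T
  then nth [ffun=> None] T j (i - j%:R) else None.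

Definition reduced_words (k : nat) (x : int -> int) : set (word k) :=
  [set w | reduced_word x w]%classic.

Definition recording_tableaux (k : nat) (alpha : {ffun residue k -> nat}) :
    set (residue k -> nat -> option nat) :=
  [set Q | exists w : word k,
     [/\ exists2 y, affine_perm k y & reduced_word y w,
         insertion w = Some (code_filling alpha)
       & Q = @recording k w]]%classic.

(* Main.v *)
(* Everything takes place in the affine symmetric group acting on Z, where d_A
   is an explicit permutation. Each insertion step is an identity of the form
   d_A s_p = s_(p-1) d_A', so insertion preserves the product, and reaching
   zero would exhibit a shorter word. Insertion also keeps the rows nested, as
   the rows of the filling of a k-code are. A nested decomposition
   x = d_(A_n) ... d_(A_1) is unique: A_1 consists of the residues i such that
   i + 1 is not a left-to-right maximum of x, and d_(A_1) can be cancelled.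
   Hence the reduced words of x are the reduced words inserting to alpha.
   Labelled insertion can be undone: the largest label marks the box added by
   the Inclusion step, and in each row below, a Bump at p has removed p - 1
   from the row while a Braid at p has left it there. *)
Require Import Defs.
From mathcomp Require Import all_boot all_order all_algebra.
From mathcomp Require Import mathcomp_extra boolp classical_sets functions.
From mathcomp Require Import zify ring.

Set Implicit Arguments.
Unset Strict Implicit.
Unset Printing Implicit Defensive.

Import Order.TTheory GRing.Theory Num.Theory.

Local Open Scope ring_scope.

(** * Permutations of Z given by words, and the nil-Coxeter relations *)

Section Words.
Variable k : nat.
Implicit Types (i p : residue k) (A B : {set residue k}) (u v w : word k).

Lemma simple_refl_up i (m : int) : m%:~R = i -> simple_refl i m = m + 1.
Proof. by rewrite /simple_refl => ->; rewrite eqxx. Qed.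

Lemma addr1_neq i : i + 1 != i.
Proof. by rewrite -subr_eq0 addrAC subrr add0r oner_eq0. Qed.

Lemma subr1_neq i : i - 1 != i.
Proof. by rewrite -subr_eq0 addrAC subrr add0r oppr_eq0 oner_eq0. Qed.

Lemma simple_refl_down i (m : int) : m%:~R = i + 1 -> simple_refl i m = m - 1.
Proof. by rewrite /simple_refl => ->; rewrite (negPf (addr1_neq i)) eqxx. Qed.

Lemma simple_refl_fix i (m : int) :
  m%:~R != i -> m%:~R != i + 1 -> simple_refl i m = m.
Proof. by rewrite /simple_refl => /negPf -> /negPf ->. Qed.

Variant simple_refl_spec i (m : int) : int -> Prop :=
| SimpleReflUp of m%:~R = i : simple_refl_spec i m (m + 1)
| SimpleReflDown of m%:~R = i + 1 : simple_refl_spec i m (m - 1)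
| SimpleReflFix of m%:~R != i & m%:~R != i + 1 : simple_refl_spec i m m.

Lemma simple_reflP i m : simple_refl_spec i m (simple_refl i m).
Proof.
have [e|ne] := eqVneq (m%:~R : residue k) i.
  by rewrite simple_refl_up //; constructor.
have [e|ne'] := eqVneq (m%:~R : residue k) (i + 1).
  by rewrite simple_refl_down //; constructor.
by rewrite simple_refl_fix //; constructor.
Qed.

Lemma simple_reflK i : involutive (@simple_refl k i).
Proof.
move=> m; case: (simple_reflP i m) => [e|e|*]; last exact: simple_refl_fix.
- by rewrite simple_refl_down ?addrK // intrD e.
- by rewrite simple_refl_up ?subrK // intrB e addrK.
Qed.

Lemma word_perm_cat u v : word_perm (u ++ v) = word_perm u \o word_perm v.
Proof. by elim: u => //= i u ->. Qed.

Lemma word_perm_rcons u i :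
  word_perm (rcons u i) = word_perm u \o simple_refl i.
Proof. by rewrite -cats1 word_perm_cat. Qed.

Lemma word_perm_revK u : cancel (word_perm (rev u)) (word_perm u).
Proof.
move=> m; elim: u => //= i u IH in m *.
by rewrite rev_cons word_perm_rcons /= IH simple_reflK.
Qed.

Definition reduced u :=
  forall v, word_perm v = word_perm u -> (size u <= size v)%N.

Lemma reduced_wordP (x : int -> int) w :
  reduced_word x w <-> word_perm w = x /\ reduced w.
Proof.
split=> [[/funext <-] r | [<- r]]; split=> // v.
  by move=> e; apply: r => m; rewrite e.
by move=> /funext; exact: r.
Qed.

Lemma reduced_rcons w i : reduced (rcons w i) -> reduced w.
Proof.
move=> r v e; have := r (rcons v i).
by rewrite !word_perm_rcons e !size_rcons ltnS; apply.
Qed.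

Lemma simple_refl_comm i j m : j \notin [:: i - 1; i; i + 1] ->
  simple_refl i (simple_refl j m) = simple_refl j (simple_refl i m).
Proof.
rewrite !inE !negb_or => /and3P[j1 j2 j3].
have j4 : j + 1 != i by apply: contraNneq j1 => <-; rewrite addrK.
have j5 : j + 1 != i + 1 by rewrite (inj_eq (addIr _)).
case: (simple_reflP i m) => [e|e|e e'].
- have -> : simple_refl j m = m.
    by rewrite simple_refl_fix // e eq_sym.
  rewrite simple_refl_up // simple_refl_fix // intrD e eq_sym //.
- have -> : simple_refl j m = m.
    by rewrite simple_refl_fix // e eq_sym.
  by rewrite simple_refl_down // simple_refl_fix // intrB e addrK eq_sym.
case: (simple_reflP j m) => [f|f|f f']; rewrite simple_refl_fix //.
- by rewrite intrD f.
- by rewrite intrD f.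
- by rewrite intrB f addrK.
- by rewrite intrB f addrK.
Qed.

Lemma simple_refl_braid i m : (2 <= k)%N ->
  simple_refl i (simple_refl (i + 1) (simple_refl i m)) =
  simple_refl (i + 1) (simple_refl i (simple_refl (i + 1) m)).
Proof.
move=> hk.
(* This is where [2 <= k] enters: [i], [i + 1] and [i + 2] are pairwise distinct residues, and the
   case split on [m] runs over them. *)
have two : (1 + 1 : residue k) != 0.
  by case: k hk => [|[|n]].
have i2 : i + 1 + 1 != i.
  by rewrite -addrA -subr_eq0 addrAC subrr add0r.
have i1 := addr1_neq i.
have i3 := addr1_neq (i + 1).
have [e|e1] := eqVneq (m%:~R : residue k) i.
  rewrite (simple_refl_up e) (@simple_refl_up (i + 1) (m + 1)) ?intrD ?e //.
  rewrite (@simple_refl_fix i (m + 1 + 1)) ?intrD ?e //.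
  rewrite (@simple_refl_fix (i + 1) m) ?intrD ?e 1?eq_sym //.
  by rewrite (simple_refl_up e) (@simple_refl_up (i + 1) (m + 1)) ?intrD ?e.
have [e|e2] := eqVneq (m%:~R : residue k) (i + 1).
  rewrite (simple_refl_down e) (simple_refl_up e).
  rewrite (@simple_refl_fix (i + 1) (m - 1)) ?intrD ?intrB ?e ?addrK //;
    rewrite 1?eq_sym //.
  rewrite simple_refl_up ?intrB ?e ?addrK //.
  rewrite (@simple_refl_fix i (m + 1)) ?intrD ?e //.
  by rewrite simple_refl_down ?intrD ?e //; lia.
have [e|e3] := eqVneq (m%:~R : residue k) (i + 1 + 1).
  rewrite (simple_refl_down e) (simple_refl_fix e1 e2) (simple_refl_down e).
  have e4 : ((m - 1)%:~R : residue k) = i + 1 by rewrite intrB e addrK.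
  rewrite (simple_refl_down e4).
  by rewrite simple_refl_fix // intrB e4 addrK // eq_sym.
by rewrite !(simple_refl_fix e1 e2, simple_refl_fix e2 e3).
Qed.

(* Constant on the classes of [nilcoxeter_eq]: non-reduced words vanish. *)
Definition nilcoxeter_val (a : option (word k)) : option (int -> int) :=
  if a is Some w then if `[< reduced w >] then Some (word_perm w) else None
  else None.

Lemma nilcoxeter_val_eq_size u v : word_perm u = word_perm v ->
  size u = size v -> nilcoxeter_val (Some u) = nilcoxeter_val (Some v).
Proof. by rewrite /nilcoxeter_val /reduced => -> ->. Qed.

(** Commutation and braid moves preserve both the permutation and the length, hence also
    reducedness. Deleting a square leaves the permutation unchanged, so a word containing one is not
    reduced. *)
Lemma nilcoxeter_val_eq a b :
  nilcoxeter_eq a b -> nilcoxeter_val a = nilcoxeter_val b.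
Proof.
elim=> {a b} // [a b c _ -> _ -> // | u i v | u i j v ij | u i v hk].
- rewrite /nilcoxeter_val asboolF // => /(_ (u ++ v)).
  rewrite !word_perm_cat !size_cat /= addnS addnS => h.
  have /h : word_perm u \o word_perm v =
            word_perm u \o (simple_refl i \o (simple_refl i \o id)
              \o word_perm v).
    by apply/funext => m /=; rewrite simple_reflK.
  lia.
- apply: nilcoxeter_val_eq_size; last by rewrite !size_cat.
  rewrite !word_perm_cat; apply/funext => m /=.
  by rewrite simple_refl_comm.
- apply: nilcoxeter_val_eq_size; last by rewrite !size_cat.
  rewrite !word_perm_cat; apply/funext => m /=.
  by rewrite simple_refl_braid.
Qed.

(** The representative [r] is reduced, so the common value of the class is not [None] and must be
    the permutation of [w]. *)
Lemma nilcoxeter_permE w (x : int -> int) :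
  nilcoxeter_perm (Some w) x -> word_perm w = x.
Proof.
case=> r /reduced_wordP[rx rr] /nilcoxeter_val_eq /=.
by rewrite (asboolT rr); case: asboolP => // _ [->].
Qed.

End Words.

(** * Cyclically decreasing elements as permutations of Z *)

Section CyclicShift.
Variable k : nat.
Implicit Types (i p : residue k) (A B : {set residue k}) (u v w : word k).

(* The action of d_A on Z. *)
Definition cyclic_shift A (g : int -> int) : Prop := forall m : int,
  if m%:~R - 1 \in A then g m = m - 1
  else exists t : nat, [/\ g m = m + t%:Z, m%:~R + t%:R \notin A
    & forall s : nat, (s < t)%N -> m%:~R + s%:R \in A].

Lemma cyclic_shift_uniq A g h : cyclic_shift A g -> cyclic_shift A h -> g = h.
Proof.
move=> Gg Gh; apply/funext => m.
have := Gg m; have := Gh m; case: ifP => [_ -> -> // | _].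
move=> [t [-> tA tin]] [s [-> sA sin]].
have [st|ts|-> //] := ltngtP s t.
- by rewrite tin in sA.
- by rewrite sin in tA.
Qed.

Lemma cyclic_shift0 : cyclic_shift finset.set0 id.
Proof. by move=> m; rewrite inE; exists 0%N; rewrite addr0 inE. Qed.

(** On the left, [s_i] prolongs by one step the runs of [A] that stopped at [i], and sends the
    points of class [i + 1], which [g] fixes, down to class [i]. *)
Lemma cyclic_shift_consl A g i : i \notin A -> i + 1 \notin A ->
  cyclic_shift A g -> cyclic_shift (i |: A) (simple_refl i \o g).
Proof.
move=> iA i1A Gg m; have := Gg m; rewrite !inE /=.
have [e|ne] := eqVneq (m%:~R - 1) i.
  have {}e : m%:~R = i + 1 by rewrite -e subrK.
  rewrite e addrK (negPf iA) => -[[|t] [-> tA tin]].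
    by rewrite addr0 simple_refl_down.
  by have := tin 0%N isT; rewrite addr0 (negPf i1A).
have [mA|mA] /= := ifPn.
  move=> ->; apply: simple_refl_fix; rewrite intrB //.
  by apply: contraNneq i1A => <-.
move=> [t [-> tA tin]].
have mt : (m + t%:Z)%:~R = m%:~R + t%:R :> residue k by rewrite intrD.
case: (simple_reflP i (m + t)) => [e|e|e1 e2].
- exists t.+1; split.
  + by rewrite -addn1 PoszD addrA.
  + by rewrite -natr1 addrA -mt e !inE negb_or addr1_neq.
  + move=> s; rewrite ltnS leq_eqVlt => /predU1P[->|st].
      by rewrite -mt e !inE eqxx.
    by rewrite !inE tin // orbT.
- case: t tA tin mt e => [|t] tA tin mt e.
    by move: ne; rewrite -(addr0 m) e addrK eqxx.
  move: (tin t (ltnSn t)) iA.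
  rewrite (_ : m%:~R + t%:R = i) => [->//|].
  by rewrite -(addrK 1 i) -e mt -natr1 addrA addrK.
- exists t; split => //.
  + by rewrite !inE negb_or -mt e1 mt.
  + by move=> s st; rewrite !inE tin // orbT.
Qed.

(** Mirror image of the previous lemma: a point of class [p] steps to [p + 1] and follows the run
    from there, while one of class [p + 1] goes down to class [p], which [g] fixes. *)
Lemma cyclic_shift_consr A g p : p \notin A -> p - 1 \notin A ->
  cyclic_shift A g -> cyclic_shift (p |: A) (g \o simple_refl p).
Proof.
move=> pA p1A Gg m; rewrite /= !inE.
case: (simple_reflP p m) => [e|e|e1 e2].
- rewrite e (negPf p1A) eq_sym -subr_eq0 opprB addrC subrK oner_eq0 /=.
  have := Gg (m + 1); rewrite intrD e addrK (negPf pA) => -[t [-> tA tin]].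
  exists t.+1; split.
  + by rewrite -addrA -PoszD add1n.
  + rewrite -natr1 [t%:R + 1]addrC addrA !inE negb_or tA andbT.
    (* The run from [p + 1] cannot wrap around and stop at [p]: it would have passed through
       [p - 1]. *)
    case: t tA tin => [|t] _ tin; first by rewrite addr0 addr1_neq.
    apply: contraNneq p1A => {1}<-.
    by rewrite -natr1 addrA addrK tin.
  + case=> [|s] st; first by rewrite addr0 !inE eqxx.
    by rewrite -natr1 [s%:R + 1]addrC addrA !inE tin ?orbT.
- rewrite e addrK eqxx /=.
  have := Gg (m - 1); rewrite intrB e addrK (negPf p1A).
  move=> [[|t] [-> _ tin]]; first by rewrite addr0.
  by have := tin 0%N isT; rewrite addr0 (negPf pA).
- have -> : (m%:~R - 1 == p) = false.
    by apply: contra_neqF e2 => /eqP <-; rewrite subrK.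
  have := Gg m; case: ifP => //= m1A [t [-> tA tin]].
  exists t; split => //; last by move=> s st; rewrite !inE tin ?orbT.
  rewrite !inE negb_or tA andbT.
  case: t tA tin => [|t] _ tin; first by rewrite addr0.
  apply: contraNneq p1A => <-.
  by rewrite -natr1 addrA addrK tin.
Qed.

(** [g] subtracts 1 on the classes of [p] and [p + 1], so it carries [s_p] to [s_(p-1)] there. It
    sends no other point into the classes of [p - 1] and [p], since runs stop outside [A]. *)
Lemma cyclic_shift_braid A g p : p \in A -> p - 1 \in A -> cyclic_shift A g ->
  g \o simple_refl p = simple_refl (p - 1) \o g.
Proof.
move=> pA p1A Gg; apply/funext => m /=.
have gp m' : m'%:~R = p -> g m' = m' - 1.
  by move=> e; have := Gg m'; rewrite e p1A.
have gp1 m' : m'%:~R = p + 1 -> g m' = m' - 1.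
  by move=> e; have := Gg m'; rewrite e addrK pA.
case: (simple_reflP p m) => [e|e|e1 e2].
- rewrite gp1 ?intrD ?e // gp // simple_refl_up ?intrB ?e //; ring.
- rewrite gp ?intrB ?e ?addrK // gp1 //.
  by rewrite simple_refl_down ?intrB ?e ?addrK ?subrK.
- rewrite simple_refl_fix // ?subrK.
    have := Gg m; case: ifP => [_ -> | _ [t [-> tA _]]].
      by rewrite intrB; apply: contraNneq e1 => /addIr ->.
    by rewrite intrD; apply: contraNneq tA => ->.
  have := Gg m; case: ifP => [_ -> | _ [t [-> tA _]]].
    by rewrite intrB; apply: contraNneq e2 => <-; rewrite subrK.
  by rewrite intrD; apply: contraNneq tA => ->.
Qed.

(** Induction on the word: [i + 1] cannot occur after the first letter [i], so [cyclic_shift_consl]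
    adds that letter. *)
Lemma cyc_decreasing_shift A u :
  cyc_decreasing_word A u -> cyclic_shift A (word_perm u).
Proof.
elim: u A => [|i u IH] A.
  case/and3P => _ /eqP <- _; rewrite (_ : [set _ in _] = finset.set0).
    exact: cyclic_shift0.
  by apply/setP => j; rewrite !inE.
case/and3P => /= /andP[iu uu] /eqP <- /forall_inP dec.
have -> : [set j in i :: u] = i |: [set j in u].
  by apply/setP => j; rewrite !inE.
apply: cyclic_shift_consl; rewrite ?inE //.
  apply/negP => i1u; have := dec (i + 1); rewrite !inE i1u orbT addrK eqxx.
  by move=> /(_ isT) /=.
apply: IH; rewrite /cyc_decreasing_word uu eqxx /=.
apply/forall_inP => j; rewrite inE => ju; apply/implyP; rewrite inE => j1u.
have := dec j; rewrite !inE ju j1u !orbT /= => /(_ isT).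
have /negPf -> : i != j by apply: contraNneq iu => ->.
by have /negPf -> : i != j - 1 by apply: contraNneq iu => ->.
Qed.

Lemma set_pred_closed A : A != finset.set0 -> A != [set: residue k] ->
  exists2 p, p \in A & p - 1 \notin A.
Proof.
move=> /set0Pn[p0 p0A] AT; apply: contrapT => h.
have cl p : p \in A -> p - 1 \in A.
  by move=> pA; apply: contrapT => /negP p1A; apply: h; exists p.
have clt (t : nat) : p0 - t%:R \in A.
  elim: t => [|t IH]; first by rewrite subr0.
  by rewrite -natr1 opprD addrA cl.
move/negP: AT; apply; apply/eqP/setP => q; rewrite inE.
by have := clt (p0 - q : residue k); rewrite natr_Zp opprB addrC subrK.
Qed.

(** An element [p] of [A] with [p - 1] outside [A] can be split off as the last letter, by
    [cyclic_shift_consr]. *)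
Lemma cyclic_shift_exists A : A != [set: residue k] ->
  exists2 u : word k, size u = #|A| & cyclic_shift A (word_perm u).
Proof.
have [n leAn] := ubnP #|A|; elim: n A leAn => // n IH A leAn AT.
have [->|A0] := eqVneq A finset.set0.
  by exists [::]; [rewrite cards0 | exact: cyclic_shift0].
have [p pA p1A] := set_pred_closed A0 AT.
have cA := cardsD1 p A; rewrite pA in cA.
have [||u su Gu] := IH (A :\ p).
- by move: leAn; rewrite cA.
- by apply/eqP => /setP /(_ p); rewrite !inE eqxx.
exists (rcons u p); first by rewrite size_rcons cA su.
rewrite word_perm_rcons -(finset.setD1K pA); apply: cyclic_shift_consr => //.
  by rewrite !inE eqxx.
by rewrite !inE negb_and p1A orbT.
Qed.

(** A fixed word for [d_A]. The default [[::]] stands in when no word exists, which does not happen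
    for proper [A]. *)
Definition cyc_word A : word k :=
  xget [::]
    [set u : word k | size u = #|A| /\ cyclic_shift A (word_perm u)]%classic.

Lemma cyc_wordP A : A != [set: residue k] ->
  size (cyc_word A) = #|A| /\ cyclic_shift A (word_perm (cyc_word A)).
Proof.
move=> /cyclic_shift_exists[u su Gu].
exact: (@xgetI _ [::] [set v : word k |
  size v = #|A| /\ cyclic_shift A (word_perm v)]%classic u).
Qed.

End CyclicShift.

(** * Products of rows and uniqueness of nested fillings *)

Section Fillings.
Variable k : nat.
Implicit Types (p : residue k) (A B : {set residue k}) (v w : word k).
Implicit Types (R S : seq {set residue k}).

Local Notation cyc A := (word_perm (cyc_word A)).

Lemma cycE A g : A != [set: residue k] -> cyclic_shift A g -> cyc A = g.
Proof. by move=> /cyc_wordP[_ Gc] Gg; exact: cyclic_shift_uniq Gc Gg. Qed.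

Lemma notin_neqT A p : p \notin A -> A != [set: residue k].
Proof. by apply: contraNneq => ->; rewrite inE. Qed.

Lemma cyc_inclusion A p : p \notin A -> p - 1 \notin A ->
  p |: A != [set: residue k] /\ cyc (p |: A) = cyc A \o simple_refl p.
Proof.
move=> pA p1A; have AT : p |: A != [set: residue k].
  by apply: (@notin_neqT _ (p - 1)); rewrite !inE negb_or subr1_neq.
split=> //; apply: cycE => //; apply: cyclic_shift_consr => //.
exact: (cyc_wordP (notin_neqT pA)).2.
Qed.

(** Here [d_A] has a word ending in [p], which [s_p] cancels. This is the shorter word that excludes
    the zero case for reduced words. *)
Lemma cyc_zero A p : p \in A -> p - 1 \notin A ->
  cyc (A :\ p) = cyc A \o simple_refl p.
Proof.
move=> pA p1A; have [||_] := @cyc_inclusion (A :\ p) p.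
- by rewrite !inE eqxx.
- by rewrite !inE negb_and p1A orbT.
rewrite finset.setD1K // => ->.
by apply/funext => m /=; rewrite simple_reflK.
Qed.

(* Both sides factor through d_B, where B = A minus p - 1. *)
Lemma cyc_bump A p : p \notin A -> p - 1 \in A ->
  cyc A \o simple_refl p = simple_refl (p - 1) \o cyc (p |: (A :\ (p - 1))).
Proof.
move=> pA p1A; set B := A :\ (p - 1).
have pB : p \notin B by rewrite !inE negb_and pA orbT.
have p1B : p - 1 \notin B by rewrite !inE eqxx.
have [_ ->] := cyc_inclusion pB p1B.
rewrite (_ : cyc A = simple_refl (p - 1) \o cyc B) //.
apply: cycE; first exact: notin_neqT pA.
rewrite -(finset.setD1K p1A); apply: cyclic_shift_consl => //.
  by rewrite subrK.
exact: (cyc_wordP (notin_neqT pB)).2.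
Qed.

Definition filling_word R : word k :=
  flatten (rev [seq cyc_word A | A <- R]).

Lemma filling_word_cons A R :
  filling_word (A :: R) = filling_word R ++ cyc_word A.
Proof. by rewrite /filling_word /= rev_cons flatten_rcons. Qed.

Lemma filling_perm_cons A R :
  word_perm (filling_word (A :: R)) = word_perm (filling_word R) \o cyc A.
Proof. by rewrite filling_word_cons word_perm_cat. Qed.

Lemma filling_wordE R (us : seq (word k)) :
  all (fun A => A != [set: residue k]) R ->
  all2 (@cyc_decreasing_word k) R us ->
  word_perm (flatten (rev us)) = word_perm (filling_word R).
Proof.
elim: R us => [|A R IH] [|u us] //= /andP[AT RT] /andP[Au Rus].
rewrite filling_perm_cons rev_cons flatten_rcons word_perm_cat IH //.
by rewrite (cycE AT (cyc_decreasing_shift Au)).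
Qed.

(** The nesting condition that [B] is contained in [A - 1], for a row [B] standing directly on
    [A]. *)
Definition below A B := [forall r in B, r + 1 \in A].

(* The residues m - 1 in A are those for which m is not a left-to-right
   maximum of x. *)
Definition records A (x : int -> int) : Prop := forall m : int,
  if m%:~R - 1 \in A then exists2 j, j < m & x m < x j
  else forall j, j < m -> x j < x m.

Lemma records_uniq A B x : records A x -> records B x -> A = B.
Proof.
move=> Ax Bx; apply/setP => r; move: (Ax (r%:Z + 1)) (Bx (r%:Z + 1)).
have rE : (r%:Z)%:~R = r := natr_Zp r; rewrite intrD addrK rE.
have absurd : ~ ((exists2 j, j < r%:Z + 1 & x (r%:Z + 1) < x j) /\
                 forall j, j < r%:Z + 1 -> x j < x (r%:Z + 1)).
  by move=> [[j lj xj] /(_ j lj) /(lt_trans xj)]; rewrite ltxx.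
by case: ifP => _; case: ifP => _ // *; case: absurd.
Qed.

(** Integers of residue outside [A] are left-to-right maxima of [y], by nesting. If [m - 1] is
    outside [A], then [g m] is such an integer and exceeds every earlier [g j]. Otherwise
    [g m = m - 1], and the start [j] of the run of [A] through [m - 1] has [g j] beyond [m - 1] and
    outside [A]. *)
Lemma records_shift A B (y g : int -> int) :
  A != [set: residue k] -> below A B -> cyclic_shift A g ->
  records B y -> records A (y \o g).
Proof.
move=> AT /forall_inP AB Gg By m; have Gm := Gg m.
have topB (q : int) : q%:~R \notin A -> forall j, j < q -> y j < y q.
  move=> qA; have := By q; case: ifPn => // q1B.
  by have := AB _ q1B; rewrite subrK (negPf qA).
case: ifPn Gm => /= [mA -> | mA [t [-> tA _]] j jm].
- have [q qA] : exists q, q \notin A.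
    have /setP/existsNP[q] := elimN eqP AT; rewrite inE => /negP qA.
    by exists q.
  have ext : exists t : nat, (m%:~R - 1 - t%:R : residue k) \notin A.
    by exists (m%:~R - 1 - q : residue k); rewrite natr_Zp opprB addrC subrK.
  case: (ex_minnP ext) => t tA tmin.
  have t0 : (0 < t)%N by case: t tA {tmin} => //; rewrite subr0 mA.
  exists (m - t%:Z); first lia.
  have := Gg (m - t%:Z); rewrite intrB addrAC (negPf tA) => -[s [-> sA _]].
  apply: topB; first by rewrite intrD intrB.
  have [ts|st] := leqP t s; first lia.
  (* The point [m - t + s], outside [A], would lie only [t - s - 1] below [m - 1], against the
     minimality of [t]. *)
  exfalso; move: (tmin (t - s.+1)%N) => h.
  suff /h : m%:~R - 1 - (t - s.+1)%:R \notin A by lia.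
  rewrite natrB // -[s.+1%:R]natr1.
  by rewrite (_ : _ - _ = m%:~R - t%:R + s%:R) //; ring.
- apply: topB; first by rewrite intrD.
  have := Gg j; case: ifPn => [_ ->|_ [s [-> _ sin]]]; first lia.
  (* If [g j] reached [m + t], the run from [j] would pass through [m - 1]. *)
  have [|le] := ltP (j + s%:Z) (m + t%:Z) => //.
  case/negP: mA; have [d ed] : exists d : nat, m = j + 1 + d%:Z.
    by exists (absz (m - (j + 1))%R); lia.
  have -> : m%:~R - 1 = j%:~R + d%:R :> residue k.
    by rewrite ed !intrD /= addrAC addrK.
  apply: sin; lia.
Qed.

(** Rows are added from the top down by [records_shift]. The default [set0] of [head] is right for
    the empty filling: every integer is a left-to-right maximum of the identity. *)
Lemma filling_records R : all (fun A => A != [set: residue k]) R ->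
  sorted below R -> records (head finset.set0 R) (word_perm (filling_word R)).
Proof.
elim: R => [_ _ m|A R IH /= /andP[AT RT] AR]; first by rewrite inE.
rewrite filling_perm_cons; apply: (@records_shift _ (head finset.set0 R)) => //.
- case: R AR {IH RT} => [|B R] /=; last by case/andP.
  by move=> _; apply/forall_inP => r; rewrite inE.
- exact: (cyc_wordP AT).2.
- by apply: IH => //; exact: path_sorted AR.
Qed.

Definition proper_row A := (A != finset.set0) && (A != [set: residue k]).

Lemma proper_rowT R : all proper_row R ->
  all (fun A => A != [set: residue k]) R.
Proof. by apply: sub_all => A /andP[]. Qed.

Lemma nested_filling_inj R S : all proper_row R -> all proper_row S ->
  sorted below R -> sorted below S ->
  word_perm (filling_word R) = word_perm (filling_word S) -> R = S.
Proof.
elim: R S => [|A R IH] [|B S] // Rp Sp Rs Ss e.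
- have := filling_records (R := [::]) isT isT.
  have := filling_records (proper_rowT Sp) Ss; rewrite -e.
  move=> /records_uniq h /h /= B0.
  by case/andP: Sp; rewrite /proper_row B0 eqxx.
- have := filling_records (R := [::]) isT isT.
  have := filling_records (proper_rowT Rp) Rs; rewrite e.
  move=> /records_uniq h /h /= A0.
  by case/andP: Rp; rewrite /proper_row A0 eqxx.
have := filling_records (proper_rowT Rp) Rs.
have := filling_records (proper_rowT Sp) Ss; rewrite -e.
move=> /records_uniq h /h /= BA.
rewrite {}BA in Sp Ss e *; congr (_ :: _).
case/andP: Rp => _ Rp; case/andP: Sp => _ Sp.
apply: IH => //; [exact: path_sorted Rs | exact: path_sorted Ss |].
(* The common bottom row is the rightmost factor, so it is cancelled on the right. *)
move: e; rewrite !filling_perm_cons.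
move=> /(congr1 (fun f => f \o word_perm (rev (cyc_word A)))) e.
apply/funext => m; have := congr1 (@^~ m) e.
by rewrite /= word_perm_revK.
Qed.

End Fillings.

(** * Insertion preserves the product and the nesting of rows *)

Section Insertion.
Variable k : nat.
Implicit Types (p q : residue k) (A : labelled_row k).
Implicit Types (T : seq (labelled_row k)) (v w : word k) (l : nat).

Local Notation rows T := [seq row_residues A | A : labelled_row k <- T].
Local Notation rows_perm T := (word_perm (filling_word (rows T))).
Local Notation rows_size T := (size (filling_word (rows T))).

Lemma in_row A q : (q \in row_residues A) = (A q != None).
Proof. by rewrite inE. Qed.

Lemma notin_row A q : A q = None -> q \notin row_residues A.
Proof. by rewrite in_row => ->. Qed.

Lemma row_single p l :
  row_residues [ffun q => if q == p then Some l else None] = p |: finset.set0.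
Proof. by apply/setP => q; rewrite !inE ffunE; case: (q == p). Qed.

Lemma row_put A p l :
  row_residues [ffun q => if q == p then Some l else A q] = p |: row_residues A.
Proof. by apply/setP => q; rewrite !inE ffunE; case: (q == p). Qed.

Lemma row_move A p l :
  row_residues [ffun q => if q == p then Some l
                          else if q == p - 1 then None else A q] =
  p |: (row_residues A :\ (p - 1)).
Proof.
by apply/setP => q; rewrite !inE ffunE; case: (q == p); case: (q == p - 1).
Qed.

Lemma size_filling_cons (A : {set residue k}) R : A != [set: residue k] ->
  size (filling_word (A :: R)) = (size (filling_word R) + #|A|)%N.
Proof. by move=> /cyc_wordP[sA _]; rewrite filling_word_cons size_cat sA. Qed.

(** Row by row, [s_p] either is absorbed or moves past [d_A] as [s_(p-1)]. When the product is zero,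
    the word [v] has two letters fewer than the word of the filling followed by [p]. *)
Lemma insert_perm T p l : all (@proper_row k) (rows T) ->
  if insert T p l is Some T' then
    [/\ all (@proper_row k) (rows T'), rows_size T' = (rows_size T).+1
      & rows_perm T' = rows_perm T \o simple_refl p]
  else exists2 v : word k, (size v).+1 = rows_size T &
    word_perm v = rows_perm T \o simple_refl p.
Proof.
elim: T p => [|A T IH] p /=.
  move=> _; have [|| pT ep] := @cyc_inclusion k finset.set0 p; rewrite ?inE //.
  rewrite !row_single /proper_row pT andbT /=; split.
  - by rewrite andbT; apply/set0Pn; exists p; rewrite !inE eqxx.
  - by rewrite size_filling_cons // finset.setU0 cards1.
  - rewrite filling_perm_cons ep (cycE _ (@cyclic_shift0 k)) //.
    by apply: (@notin_neqT _ _ p); rewrite inE.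
move=> /andP[/andP[A0 AT] Tp].
case Ap: (A p) => [a|]; case Ap1: (A (p - 1)) => [a1|].
- have pA : p \in row_residues A by rewrite in_row Ap.
  have p1A : p - 1 \in row_residues A by rewrite in_row Ap1.
  have eA f := congr1 (comp f) (cyclic_shift_braid pA p1A (cyc_wordP AT).2).
  have := IH (p - 1) Tp; case: (insert T (p - 1) l) => [T'|] /=.
    move=> [T'p sT' eT']; split; first by rewrite /proper_row A0 AT.
      by rewrite !size_filling_cons // sT'.
    by rewrite !filling_perm_cons eT' -[RHS]compA eA.
  move=> [v sv ev]; exists (v ++ cyc_word (row_residues A)).
    by rewrite size_filling_cons // -sv size_cat (cyc_wordP AT).1.
  by rewrite filling_perm_cons word_perm_cat ev -[RHS]compA eA.
- have pA : p \in row_residues A by rewrite in_row Ap.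
  have p1A := notin_row Ap1.
  have BT : row_residues A :\ p != [set: residue k].
    by apply: (@notin_neqT _ _ p); rewrite !inE eqxx.
  exists (filling_word (rows T) ++ cyc_word (row_residues A :\ p)).
    rewrite size_filling_cons // size_cat (cyc_wordP BT).1.
    by rewrite (cardsD1 p (row_residues A)) pA addnS.
  by rewrite filling_perm_cons word_perm_cat cyc_zero.
- have pA := notin_row Ap.
  have p1A : p - 1 \in row_residues A by rewrite in_row Ap1.
  have eA f := congr1 (comp f) (cyc_bump pA p1A).
  have BT : p |: (row_residues A :\ (p - 1)) != [set: residue k].
    apply: (@notin_neqT _ _ (p - 1)).
    by rewrite !inE eqxx (negPf (subr1_neq p)).
  have B0 : p |: (row_residues A :\ (p - 1)) != finset.set0.
    by apply/set0Pn; exists p; rewrite !inE eqxx.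
  have cB : #|p |: (row_residues A :\ (p - 1))| = #|row_residues A|.
    rewrite cardsU1 finset.in_setD1 (negPf pA) andbF.
    by rewrite (cardsD1 (p - 1) (row_residues A)) p1A.
  have := IH (p - 1) Tp; case: (insert T (p - 1) l) => [T'|] /=.
    rewrite row_move; move=> [T'p sT' eT']; split.
    + by rewrite /proper_row B0 BT.
    + by rewrite !size_filling_cons // sT' cB.
    + by rewrite !filling_perm_cons eT' -[RHS]compA eA.
  move=> [v sv ev]; exists (v ++ cyc_word (p |: (row_residues A :\ (p - 1)))).
    by rewrite size_filling_cons // -sv size_cat (cyc_wordP BT).1 cB.
  by rewrite filling_perm_cons word_perm_cat ev -[RHS]compA eA.
- have [BT eB] := cyc_inclusion (notin_row Ap) (notin_row Ap1).
  rewrite /= row_put; split.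
  + rewrite /proper_row BT Tp !andbT.
    by apply/set0Pn; exists p; rewrite !inE eqxx.
  + by rewrite !size_filling_cons // cardsU1 (notin_row Ap) addnCA.
  + by rewrite !filling_perm_cons eB.
Qed.

(* [B] is the row below [T], and [B'] what becomes of it when [p + 1] is
   inserted there and [p] is passed on to [T]. *)
Lemma insert_below (B B' : {set residue k}) T T' p l :
  insert T p l = Some T' -> path (@below k) B (rows T) ->
  (p + 1) \in B' -> (forall q, q \in B -> q != p -> q \in B') ->
  (p \in B -> p \notin B' -> p + 1 \notin B) ->
  path (@below k) B' (rows T').
Proof.
elim: T T' p B B' => [|A T IH] T' p B B' /=.
  move=> [<-] _ pB' _ _ /=; rewrite andbT row_single.
  by apply/forall_inP => q; rewrite !inE orbF => /eqP ->.
move=> ins /andP[/forall_inP BA AT] pB' BB' bump.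
have keep q : q \in row_residues A -> q != p - 1 -> q + 1 \in B'.
  move=> qA qp; apply: BB'; first exact: BA.
  by apply: contraNneq qp => <-; rewrite addrK.
case Ap: (A p) ins => [a|]; case Ap1: (A (p - 1)) => [a1|] //.
- have pA : p \in row_residues A by rewrite in_row Ap.
  have p1A : p - 1 \in row_residues A by rewrite in_row Ap1.
  case ins: (insert T (p - 1) l) => [T1|] //= [<-] /=; apply/andP; split.
    (* In a Braid, nesting puts both [p] and [p + 1] in [B], so the row below has not lost [p]. *)
    apply/forall_inP => q qA; have [->|/keep] := eqVneq q (p - 1); last exact.
    rewrite subrK; apply: contrapT => /negP pB'0.
    have := bump _ pB'0; rewrite (BA _ pA).
    by have := BA _ p1A; rewrite subrK => -> /(_ isT).
  apply: IH ins AT _ _ _ => //; first by rewrite subrK.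
  by rewrite p1A.
- have pA := notin_row Ap.
  have p1A : p - 1 \in row_residues A by rewrite in_row Ap1.
  case ins: (insert T (p - 1) l) => [T1|] //= [<-] /=.
  rewrite row_move; apply/andP; split.
    apply/forall_inP => q; rewrite !inE => /predU1P[-> //|/andP[qp qA]].
    by apply: keep => //; rewrite in_row.
  apply: IH ins AT _ _ _ => //.
  + by rewrite subrK !inE eqxx.
  + by move=> q qA qp; rewrite !inE qp -in_row qA orbT.
  + by rewrite subrK pA.
- move=> [<-] /=; have p1A := notin_row Ap1.
  rewrite row_put; apply/andP; split.
    apply/forall_inP => q; rewrite !inE => /predU1P[-> //|qA].
    rewrite -in_row in qA; apply: keep => //.
    by apply: contraNneq p1A => <-.
  case: T AT {IH} => //= C T /andP[/forall_inP AC ->]; rewrite andbT.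
  by apply/forall_inP => q qC; rewrite !inE -in_row AC ?orbT.
Qed.

(** A fictitious full row under the filling, unchanged by the insertion, meets the hypotheses of
    [insert_below]. *)
Lemma insert_nested T T' p l : insert T p l = Some T' ->
  sorted (@below k) (rows T) -> sorted (@below k) (rows T').
Proof.
have belowT (R : seq {set residue k}) :
    path (@below k) [set: residue k] R = sorted (@below k) R.
  case: R => //= A R; case: (path _ A R); rewrite ?andbF // andbT.
  by apply/forall_inP => q; rewrite inE.
rewrite -!belowT => ins pT.
by apply: insert_below ins pT _ _ _; rewrite ?inE.
Qed.

(** * Undoing a labelled insertion *)

Definition fresh l T : Prop := forall A, A \in T -> forall q, A q <> Some l.

Lemma fresh_cons l A T :
  fresh l (A :: T) <-> (forall q, A q <> Some l) /\ fresh l T.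
Proof.
split=> [h|[hA hT] B]; last by rewrite inE => /predU1P[->|/hT].
by split=> [|B BT]; apply: h; rewrite inE ?eqxx ?BT ?orbT.
Qed.

Lemma insert_fresh T T' p l m : insert T p l = Some T' -> m <> l ->
  fresh m T -> fresh m T'.
Proof.
move=> + ml; have lm : Some l <> Some m by move=> [/esym].
elim: T T' p => [|A T IH] T' p /=.
  by move=> [<-] _; apply/fresh_cons; split=> // q; rewrite ffunE; case: ifP.
move=> + /fresh_cons[mA mT].
case Ap: (A p) => [a|]; case Ap1: (A (p - 1)) => [a1|] //.
- case ins: insert => [T1|] //= [<-]; apply/fresh_cons; split=> //.
  exact: IH ins mT.
- case ins: insert => [T1|] //= [<-]; apply/fresh_cons; split.
    by move=> q; rewrite ffunE; case: ifP => _; [rewrite -Ap1 | case: ifP].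
  exact: IH ins mT.
- move=> [<-]; apply/fresh_cons; split=> // q; rewrite ffunE.
  by case: ifP.
Qed.

(** Applied to a row after the insertion: if [p - 1] is still there, a Braid left the row alone;
    otherwise the label at [p] goes back to [p - 1]. *)
Definition unbump A p : labelled_row k :=
  [ffun q => if A (p - 1) is Some _ then A q
             else if q == p then None else if q == p - 1 then A p else A q].

(** Bump and Braid form one case: either way [unbump] recovers the old row, and the new row carries
    only old labels. *)
Variant insert_cons_spec A T p l : seq (labelled_row k) -> Prop :=
| InsertHere of A p = None & A (p - 1) = None :
  insert_cons_spec A T p l
    ([ffun q => if q == p then Some l else A q] :: T)
| InsertAbove A' T' of insert T (p - 1) l = Some T' & A' p <> None
    & A = unbump A' p & (forall q, A' q <> None -> exists q', A q' = A' q) :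
  insert_cons_spec A T p l (A' :: T').

Lemma insert_consP A T T' p l :
  insert (A :: T) p l = Some T' -> insert_cons_spec A T p l T'.
Proof.
rewrite /=; case Ap: (A p) => [a|]; case Ap1: (A (p - 1)) => [b|] //.
- case ins: insert => [T1|] //= [<-]; constructor => //; first by rewrite Ap.
    by apply/ffunP => q; rewrite ffunE Ap1.
  by move=> q _; exists q.
- case ins: insert => [T1|] //= [<-]; constructor => //.
  + by rewrite ffunE eqxx.
  + apply/ffunP => q; rewrite !ffunE !eqxx (negPf (subr1_neq p)).
    by case: eqP => [->|_]; [rewrite Ap | case: eqP => [->|]].
  + move=> q; rewrite ffunE; case: ifP => _; first by exists (p - 1).
    by case: ifP => // _ _; exists q.
- by move=> [<-]; constructor.
Qed.

(** A row that had a box keeps some old label, whereas the row created from the empty filling has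
    only the label [l]. *)
Lemma insert_nil_neq A T T' p q l : fresh l (A :: T) ->
  row_residues A != finset.set0 ->
  insert [::] p l = Some T' -> insert (A :: T) q l <> Some T'.
Proof.
move=> /fresh_cons[lA _] /set0Pn[r]; rewrite in_row => /eqP Ar [<-].
set S := [ffun _ => _]; have SE r' : S r' <> None -> S r' = Some l.
  by rewrite ffunE; case: ifP.
move eT: [:: S] => T1 /insert_consP i.
case: i eT => [Aq _ | B T2 _ Bq _ AB] [eS _].
  have := congr1 (fun f : labelled_row k => f r) eS.
  rewrite [RHS]ffunE; case: eqP => [rq|_ SA]; first by rewrite rq in Ar.
  by apply: (lA r); rewrite -SA; apply: SE; rewrite SA.
rewrite -{B}eS in Bq AB; have [q' Aq'] := AB q Bq.
by apply: (lA q'); rewrite Aq' SE.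
Qed.

(** The label [l] marks where the insertion halted, so both insertions halt in the same row and at
    the same residue; the rows below are recovered by [unbump]. Nonempty rows distinguish opening a
    new row from joining an old one. *)
Lemma insert_inj T1 T2 p1 p2 l T :
  fresh l T1 -> fresh l T2 ->
  finset.set0 \notin rows T1 -> finset.set0 \notin rows T2 ->
  insert T1 p1 l = Some T -> insert T2 p2 l = Some T -> T1 = T2 /\ p1 = p2.
Proof.
elim: T1 T2 p1 p2 T => [|A1 T1 IH] [|A2 T2] p1 p2 T l1 l2.
- move=> _ _ [<-] [] /ffunP /(_ p1); rewrite !ffunE eqxx.
  by case: eqP.
- rewrite (in_cons (row_residues A2)) negb_or eq_sym => _ /andP[n2 _] e1 e2.
  by case: (insert_nil_neq l2 n2 e1 e2).
- rewrite (in_cons (row_residues A1)) negb_or eq_sym => /andP[n1 _] _ e1 e2.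
  by case: (insert_nil_neq l1 n1 e2 e1).
rewrite !(in_cons (row_residues _)) !negb_or => /andP[_ n1] /andP[_ n2].
move=> /insert_consP i1 /insert_consP i2.
move: l1 l2 => /fresh_cons[lA1 lT1] /fresh_cons[lA2 lT2].
case: i1 i2 => [A1p A1p1|A' T' ins1 A'p1 e1 AA1].
- move eT: ([ffun _ => _] :: T1) => T0 i2.
  case: i2 eT => [A2p A2p1|A' T' _ _ _ AA2] [eA eT].
    have p12 : p1 = p2.
      have := congr1 (fun f : labelled_row k => f p1) eA.
      rewrite !ffunE eqxx; case: eqP => // _ /esym A2l.
      by case: (lA2 p1).
    rewrite eT -p12 in eA A2p *; split=> //; congr (_ :: _).
    apply/ffunP => q; have := congr1 (fun f : labelled_row k => f q) eA.
    by rewrite !ffunE; case: eqP => [-> _|//]; rewrite A1p A2p.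
  (* If one insertion halts here and the other goes on, [l] would be a label of the old row. *)
  have A'l : A' p1 = Some l by rewrite -eA ffunE eqxx.
  have [|q A2q] := AA2 p1; first by rewrite A'l.
  by case: (lA2 q); rewrite A2q.
move eT: (A' :: T') => T0 i2.
case: i2 eT => [A2p A2p1|A2' T2' ins2 A'p2 e2 AA2] [eA eT].
  have A'l : A' p2 = Some l by rewrite eA ffunE eqxx.
  have [|q A1q] := AA1 p2; first by rewrite A'l.
  by case: (lA1 q); rewrite A1q.
rewrite -eT in ins2; have [-> /addIr p12] := IH _ _ _ _ lT1 lT2 n1 n2 ins1 ins2.
by rewrite e1 e2 p12 eA.
Qed.

(** * Insertion of whole words, and the filling of a code *)

Lemma insert_word_rcons w p :
  insert_word (rcons w p) =
  obind (fun T => insert T p (size w).+1) (insert_word w).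
Proof.
rewrite /insert_word size_rcons -[X in iota _ X]addn1 iotaD add1n -cats1.
by rewrite zip_cat ?size_iota // foldl_cat.
Qed.

Lemma insert_word_fresh w T m : insert_word w = Some T -> (size w < m)%N ->
  fresh m T.
Proof.
elim/last_ind: w T m => [|w p IH] T m; first by move=> [<-].
rewrite insert_word_rcons size_rcons.
case ew: insert_word => [T0|] //= ins lm.
apply: insert_fresh ins _ (IH _ _ ew (ltnW lm)).
by move=> em; rewrite em ltnn in lm.
Qed.

Lemma insert_word_perm w T : insert_word w = Some T ->
  [/\ all (@proper_row k) (rows T), sorted (@below k) (rows T),
      rows_size T = size w & rows_perm T = word_perm w].
Proof.
elim/last_ind: w T => [|w p IH] T; first by move=> [<-].
rewrite insert_word_rcons size_rcons word_perm_rcons.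
case ew: insert_word => [T0|] //= ins; have [T0p T0s <- <-] := IH _ ew.
have := insert_perm p (size w).+1 T0p; rewrite ins => -[Tp sT eT].
by split=> //; exact: insert_nested ins T0s.
Qed.

Lemma insert_word_reduced w : reduced w -> exists T, insert_word w = Some T.
Proof.
elim/last_ind: w => [|w p IH] red; first by exists [::].
rewrite insert_word_rcons; have [T0 ew] := IH (reduced_rcons red).
rewrite ew /=; have [T0p _ sT0 eT0] := insert_word_perm ew.
have := insert_perm p (size w).+1 T0p; case: insert => [T _|]; first by exists T.
move=> [v sv ev]; have := red v.
rewrite ev eT0 -word_perm_rcons size_rcons => /(_ erefl).
by rewrite -sT0 -sv ltnNge leqnSn.
Qed.

(** Equal lengths give the two last letters the same fresh label, so [insert_inj] peels them off
    together. *)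
Lemma insert_word_inj w v T : size w = size v ->
  insert_word w = Some T -> insert_word v = Some T -> w = v.
Proof.
elim/last_ind: w v T => [|w p IH] v T; first by case: v.
elim/last_ind: v => [|v q _]; first by rewrite size_rcons.
rewrite !size_rcons !insert_word_rcons => -[swv].
case ew: insert_word => [T1|] //= ins1.
case ev: insert_word => [T2|] //= ins2; rewrite -swv in ins2.
have n0 R : all (@proper_row k) R -> finset.set0 \notin R.
  by move=> /allP Rp; apply/negP => /Rp; rewrite /proper_row eqxx.
have [/n0 T1p _ _ _] := insert_word_perm ew.
have [/n0 T2p _ _ _] := insert_word_perm ev.
have f1 := insert_word_fresh ew (ltnSn _).
have f2 : fresh (size w).+1 T2 by apply: insert_word_fresh ev _; rewrite swv.
have [eT ->] := insert_inj f1 f2 T1p T2p ins1 ins2.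
by rewrite (IH v T1) // ev eT.
Qed.

(* [recording] does not see empty rows, hence the condition on sizes. *)
Lemma recording_inj w v T T' : insert_word w = Some T ->
  insert_word v = Some T' -> size T = size T' ->
  recording w = recording v -> T = T'.
Proof.
move=> ew ev sT eR; apply: (@eq_from_nth _ [ffun=> None]) => // j _.
(* The box of residue [r] in row [j] lies in column [r + j]. *)
apply/ffunP => r; have := congr1 (fun f => f (r + j%:R) j) eR.
by rewrite /recording ew ev addrK.
Qed.

(** Each box above the first row stands on a box of the same column, whose residue is larger by
    1. *)
Lemma code_filling_nested (alpha : {ffun residue k -> nat}) :
  sorted (@below k) (code_filling alpha).
Proof.
have succ n m : sorted (fun i j => j == i.+1) (iota m n).
  by elim: n m => //= -[|n] IH m //=; rewrite eqxx; exact: (IH m.+1).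
rewrite sorted_map.
apply: (sub_sorted (e := fun i j => j == i.+1)); last exact: succ.
move=> i j /eqP ->; apply/forall_inP => r /imsetP[c]; rewrite inE => ca ->.
apply/imsetP; exists c; first by rewrite inE ltnW.
by rewrite -natr1 opprD addrA subrK.
Qed.

End Insertion.

Theorem theorem29 (k : nat) (hk : (1 <= k)%N)
    (x : int -> int) (hx : affine_perm k x)
    (alpha : {ffun residue k -> nat}) (halpha : kcode_of x alpha) :
  set_bij (@reduced_words k x) (recording_tableaux alpha) (@recording k).
Proof.
have [_ [[alphap [us alphau]] /nilcoxeter_permE ex _]] := halpha.
have {us alphau}ex : word_perm (filling_word (code_filling alpha)) = x.
  by rewrite -(filling_wordE (proper_rowT alphap) alphau).
(* The insertion of [w] and the filling of [alpha] are nested fillings with the same product [x],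
   hence equal. *)
have ins w : reduced_word x w -> exists2 T, insert_word w = Some T &
    map (@row_residues k) T = code_filling alpha.
  move=> /reduced_wordP[ew rw]; have [T eT] := insert_word_reduced rw.
  exists T => //; have [Tp Ts _ eTw] := insert_word_perm eT.
  apply: nested_filling_inj => //; first exact: code_filling_nested.
  by rewrite eTw ew.
split.
- move=> w rw; exists w; split=> //; first by exists x.
  by have [T eT eTa] := ins w rw; rewrite /insertion eT /= eTa.
- move=> w v; rewrite !inE => rw rv eR.
  have [T eT eTa] := ins w rw; have [T' eT' eTa'] := ins v rv.
  (* Both fillings have the height of the diagram of [alpha]. *)
  have sT : size T = size T'.
    by rewrite -(size_map (@row_residues k) T) eTa -eTa' size_map.
  have eTT := recording_inj eT eT' sT eR; rewrite -{}eTT in eT'.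
  apply: insert_word_inj eT eT'; apply/eqP.
  move: rw rv => [ew rw] [ev rv].
  by rewrite eqn_leq rw ?rv.
(* Surjectivity: [w] is reduced for some [y], and the product of its insertion is both [y] and
   [x]. *)
- move=> Q [w [[y _ /reduced_wordP[ew rw]] + ->]].
  rewrite /insertion; case eT: insert_word => [T|] //= [eTa].
  exists w => //; apply/reduced_wordP; split=> //.
  by have [_ _ _ <-] := insert_word_perm eT; rewrite eTa.
Qed.
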